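(* There is a universal constant $\gamma'>0$ with the following property. Let $\overline{X}=(X_0,X_1)$ be a Banach lattice couple and let $x\in\Sigma(\overline{X})$, $x\ge 0$. Assume that $\varphi_n\in Conv$, $n=1,2,\dots$, satisfy $\sum_{n=1}^\infty\varphi_n(1)<\infty$ and $$K(t,x;\overline{X})\le\sum_{n=1}^\infty\varphi_n(t),\qquad t>0.$$ Then there exist $x_n\in\Sigma(\overline{X})$, $x_n\ge 0$, $n\in\mathbb{N}$, such that $$x=\sum_{n=1}^\infty x_n\ \ (\text{convergence in }\Sigma(\overline{X}))\quad\text{and}\quad K(t,x_n;\overline{X})\le\gamma'\varphi_n(t),\ \ n\in\mathbb{N},\ t>0.$$
   Context: All spaces are real. A Banach lattice couple $\overline{X}=(X_0,X_1)$ is a pair of Banach lattices such that there is a Hausdorff topological vector lattice $\mathcal{H}$ into which both $X_0$ and $X_1$ are embedded by continuous, interval preserving, injective lattice homomorphisms. The sum $\Sigma(\overline{X})=X_0+X_1$ carries the norm $\|x\|_{\Sigma(\overline X)}=\inf\{\|x_0\|_{X_0}+\|x_1\|_{X_1}: x=x_0+x_1,\ x_i\in X_i\}$ and is a Banach lattice with the order inherited from $\mathcal{H}$. The Peetre $K$-functional is $$K(t,x;\overline{X})=\inf\{\|x_0\|_{X_0}+t\|x_1\|_{X_1}: x=x_0+x_1,\ x_i\in X_i,\ i=0,1\},\quad x\in\Sigma(\overline{X}),\ t>0.$$ $Conv$ is the cone of all concave nondecreasing functions $f$ on $[0,\infty)$ with $f(0)=0$ (a jump at $0$ is allowed). *)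

(* Defs.v *)
From HB Require Import structures.
From mathcomp Require Import all_boot all_order all_algebra.
From mathcomp Require Import all_classical all_reals all_analysis.

Set Implicit Arguments.
Unset Strict Implicit.
Unset Printing Implicit Defensive.

Import Order.TTheory GRing.Theory Num.Theory.
Import numFieldNormedType.Exports.

Local Open Scope classical_set_scope.
Local Open Scope ring_scope.

Reserved Notation "x <=v y" (at level 70, no associativity).

(* The order is a field of the mixin, written [x <=v y], instead of an instance
   of the library's order structures: Num.NumDomain already inherits from those
   and from the algebraic and normed ones, so Hierarchy Builder rejects any new
   join of Order.Lattice with GRing.Lmodule, or of an order with a norm. *)
HB.mixin Record isVectorLattice (R : numDomainType) E & GRing.Lmodule R E := {
  vle : rel E ;
  vle_refl : reflexive vle ;
  vle_anti : antisymmetric vle ;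
  vle_trans : transitive vle ;
  vleD2r : forall z x y : E, vle x y -> vle (x + z) (y + z) ;
  vleZ : forall (a : R) (x y : E), 0 <= a -> vle x y -> vle (a *: x) (a *: y) ;
  vjoin : E -> E -> E ;
  vmeet : E -> E -> E ;
  vjoin_lub : forall x y z : E, vle (vjoin x y) z = vle x z && vle y z ;
  vmeet_glb : forall x y z : E, vle z (vmeet x y) = vle z x && vle z y
}.

#[short(type="vectorLatticeType")]
HB.structure Definition VectorLattice (R : numDomainType) :=
  {E of GRing.Lmodule R E & isVectorLattice R E}.

Notation "x <=v y" := (vle x y) : ring_scope.

(* The modulus |x| = x \/ (- x); the notation `|x| is kept for norms. *)
Definition vabs (R : numDomainType) (E : vectorLatticeType R) (x : E) : E :=
  vjoin x (- x).

Definition solid (R : numDomainType) (E : vectorLatticeType R) (A : set E) :=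
  forall x y : E, vabs x <=v vabs y -> A y -> A x.

(* Common base of the two structures below, with no compatibility between
   topology and order. *)
HB.structure Definition PreTopologicalVectorLattice (R : realType) :=
  {E of TopologicalLmodule R E & VectorLattice R E}.

HB.mixin Record isBanachLattice (R : realType) E
    & CompleteNormedModule R E & PreTopologicalVectorLattice R E := {
  lattice_norm : forall x y : E, vabs x <=v vabs y -> `|x| <= `|y|
}.

#[short(type="banachLatticeType")]
HB.structure Definition BanachLattice (R : realType) :=
  {E of CompleteNormedModule R E & PreTopologicalVectorLattice R E
      & isBanachLattice R E}.

(* A topological vector lattice is a topological vector space (not necessarily
   locally convex) with a base of solid neighbourhoods of 0. *)
HB.mixin Record isLocallySolid (R : realType) E
    & PreTopologicalVectorLattice R E := {
  locally_solid : forall U : set E, nbhs (0 : E) U ->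
    exists V : set E, [/\ nbhs (0 : E) V, solid V & V `<=` U]
}.

#[short(type="topologicalVectorLatticeType")]
HB.structure Definition TopologicalVectorLattice (R : realType) :=
  {E of PreTopologicalVectorLattice R E & isLocallySolid R E}.

Definition lattice_homomorphism (R : numDomainType) (E F : vectorLatticeType R)
    (f : {linear E -> F}) : Prop :=
  {morph f : x y / vjoin x y} /\ {morph f : x y / vmeet x y}.

Definition interval_preserving (R : numDomainType) (E F : vectorLatticeType R)
    (f : {linear E -> F}) : Prop :=
  forall x : E, 0 <=v x ->
    f @` [set y | (0 <=v y) && (y <=v x)] =
    [set z | (0 <=v z) && (z <=v f x)].

Record banach_lattice_couple (R : realType) := BanachLatticeCouple {
  couple0 : banachLatticeType R ;
  couple1 : banachLatticeType R ;
  ambient : topologicalVectorLatticeType R ;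
  emb0 : {linear couple0 -> ambient} ;
  emb1 : {linear couple1 -> ambient} ;
  ambient_hausdorff : hausdorff_space ambient ;
  emb0_continuous : continuous emb0 ;
  emb1_continuous : continuous emb1 ;
  emb0_injective : injective emb0 ;
  emb1_injective : injective emb1 ;
  emb0_lattice_homomorphism : lattice_homomorphism emb0 ;
  emb1_lattice_homomorphism : lattice_homomorphism emb1 ;
  emb0_interval_preserving : interval_preserving emb0 ;
  emb1_interval_preserving : interval_preserving emb1
}.

Arguments emb0 {R} X : rename.
Arguments emb1 {R} X : rename.

Section Couple.
Variables (R : realType) (X : banach_lattice_couple R).

(* Sigma(X) is the subset emb0 X0 + emb1 X1 of the ambient lattice, with the
   order of the ambient lattice. *)
Definition sigma_space : set (ambient X) :=
  [set x | exists x0 x1, x = emb0 X x0 + emb1 X x1].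

(* The two infima below are meaningful on sigma_space only: elsewhere they are
   infima of the empty set. *)
Definition sigma_norm (x : ambient X) : R :=
  inf [set r | exists x0 x1,
    x = emb0 X x0 + emb1 X x1 /\ r = `|x0| + `|x1|].

Definition K_functional (t : R) (x : ambient X) : R :=
  inf [set r | exists x0 x1,
    x = emb0 X x0 + emb1 X x1 /\ r = `|x0| + t * `|x1|].

(* The terms x_ n and the limit x are meant to lie in sigma_space. *)
Definition sigma_series_cvg (x_ : nat -> ambient X) (x : ambient X) : Prop :=
  sigma_norm (x - \sum_(k < n) x_ k) @[n --> \oo] --> (0 : R).

End Couple.

Arguments sigma_space {R} X.
Arguments sigma_norm {R} X x.
Arguments K_functional {R} X t x.
Arguments sigma_series_cvg {R} X x_ x.

(* Functions on [0, +oo[ are functions on R whose values at negative reals are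
   irrelevant.  Concavity is required on the closed half-line, which still
   allows a jump at 0. *)
Definition Conv (R : realType) (f : R -> R) : Prop :=
  [/\ convex_function (`[0, +oo[ : set R^o) (fun t : R^o => - f t : R^o),
      {in `[0, +oo[ &, {homo f : s t / s <= t}}
    & f 0 = 0].

(* Main.v *)
Require Import Defs.
From mathcomp Require Import all_boot all_order all_algebra.
From mathcomp Require Import all_classical all_reals all_analysis.
From mathcomp Require Import ring lra zify.

Set Implicit Arguments.
Unset Strict Implicit.
Unset Printing Implicit Defensive.

Import Order.TTheory GRing.Theory Num.Theory.
Import numFieldNormedType.Exports.

Local Open Scope classical_set_scope.
Local Open Scope ring_scope.

(** The theorem is the K-divisibility theorem of Brudnyi and Krugljak with
    positive summands.  Two ideas carry it.

    Positivity is cheap.  Suppose that [x = \sum_n c_n] with signed [c_n] such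
    that [K(t, c_n)] is at most a constant times [phi_n(t)].  With
    [S_n = \sum_(k < n) |c_k|], the differences [x_n] of consecutive meets
    [x /\ S_(n+1) - x /\ S_n] satisfy [0 <= x_n <= |c_n|], and
    [x - \sum_(k < n) x_k = (x - S_n)^+ <= |x - \sum_(k < n) c_k|].  The
    K-functional is monotone in the modulus ([splits_within_solid]), by the
    Riesz decomposition property and because the two spaces are ideals of the
    ambient lattice; so both the bounds and the convergence pass from [c_n] to
    [x_n] ([positive_series]).

    For the signed decomposition ([K_divisibility]), let [F = \sum_n phi_n] and
    let [x = a_j + b_j] be nearly optimal for [K(2^j, x) <= F(2^j)], so that the
    norms of [a_j] and [b_j] are at most [2 F(2^j)] and [2 F(2^j) / 2^j].  It is
    enough to divide [b_0] ([right_half]): exchanging the two spaces and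
    replacing [phi(t)] by [t phi(1/t)] turns the division of [a_0] into the same
    problem.  The differences [b_i - b_j = a_j - a_i] lie in both spaces, and
    [b_0] is a telescoping sum of them.  The indices must be sparse: along a
    greedy chain [s_0 < s_1 < ...], on which [F(2^s)] grows and [F(2^s) / 2^s]
    decays at least by the factor 4 at every step ([greedy_chain]), the k-th
    difference has K-functional at most [32 F(2^(s_k)) min(1, t / 2^(s_k))].

    It is then distributed among the [phi_n] proportionally to masses [m_(n,k)],
    where [m_(n,k)] is small if [phi_n] is nearly constant on the left of [2^(s_k)]
    or nearly proportional to [t] on the right of it ([node_mass]).  Since [F]
    itself varies by the factor 4, these masses add up over [n] to at least a
    quarter of [F(2^(s_k))] ([node_mass_total]), whereas for fixed [n] the functions
    [m_(n,k) min(1, t / 2^(s_k))] add up over [k] to at most [2 phi_n(t)], by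
    telescoping ([node_mass_sum]).  If the chain stops, then beyond its last point
    [F] is essentially constant or essentially linear, and the remainder of [b_0] is
    distributed proportionally to the values of the [phi_n] at that point or to their
    slopes at infinity ([terminal_piece]).

    Concavity enters through two monotonicity properties: [phi_n(t)] is nondecreasing
    and [phi_n(t) / t] is nonincreasing ([Conv_quasiconcave]). *)

(** * Order estimates in vector lattices *)

Section VectorLattice.
Variables (R : realType) (E : vectorLatticeType R).
Implicit Types x y z w p q : E.

Lemma vle_subl x y z : (x - y <=v z) = (x <=v z + y).
Proof.
apply/idP/idP => h; first by have := vleD2r y _ _ h; rewrite subrK.
by have := vleD2r (- y) _ _ h; rewrite addrK.
Qed.

Lemma vle_subC x y z : (x - y <=v z) = (x - z <=v y).
Proof. by rewrite !vle_subl addrC. Qed.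

Lemma vsub_ge0 x y : (0 <=v x - y) = (y <=v x).
Proof.
apply/idP/idP => h; first by have := vleD2r y _ _ h; rewrite subrK add0r.
by have := vleD2r (- y) _ _ h; rewrite subrr.
Qed.

Lemma vleD x y z w : x <=v y -> z <=v w -> x + z <=v y + w.
Proof.
move=> xy zw; apply: vle_trans (vleD2r z _ _ xy) _.
by rewrite ![y + _]addrC vleD2r.
Qed.

Lemma vle_addr x y : 0 <=v y -> x <=v x + y.
Proof. by move=> y0; rewrite -{1}[x]addr0; apply: vleD => //; apply: vle_refl. Qed.

Lemma vmeet_lel x y : vmeet x y <=v x.
Proof. by have := vle_refl (vmeet x y); rewrite vmeet_glb => /andP[]. Qed.

Lemma vmeet_ler x y : vmeet x y <=v y.
Proof. by have := vle_refl (vmeet x y); rewrite vmeet_glb => /andP[]. Qed.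

Lemma vle_abs x : x <=v vabs x.
Proof. by have := vle_refl (vabs x); rewrite {1}/vabs vjoin_lub => /andP[]. Qed.

Lemma vleN_abs x : - x <=v vabs x.
Proof. by have := vle_refl (vabs x); rewrite {1}/vabs vjoin_lub => /andP[]. Qed.

Lemma vabs_ge0 x : 0 <=v vabs x.
Proof.
have := vleD (vle_abs x) (vleN_abs x); rewrite subrr => h.
have half0 : 0 <= 2^-1 :> R by rewrite invr_ge0.
have := vleZ _ _ _ half0 h; rewrite scaler0.
have -> : vabs x + vabs x = 2 *: vabs x by rewrite scaler_nat mulr2n.
by rewrite scalerA mulVf ?scale1r ?pnatr_eq0.
Qed.

Lemma vmeet_le2 x y z : y <=v z -> vmeet x y <=v vmeet x z.
Proof.
by move=> yz; rewrite vmeet_glb vmeet_lel (vle_trans _ _ _ (vmeet_ler x y)).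
Qed.

(** [x - x /\ y] is the positive part of [x - y], hence below every positive
    upper bound of [x - y]. *)
Lemma vsub_meet_le x y w : 0 <=v w -> x - y <=v w -> x - vmeet x y <=v w.
Proof.
move=> w0 xyw; rewrite vle_subC vmeet_glb -[_ <=v y]vle_subC xyw andbT.
by rewrite vle_subl vle_addr.
Qed.

(** The map [y |-> x /\ y] is a contraction for the order. *)
Lemma vmeetD_sub_le x y w : 0 <=v w -> vmeet x (y + w) - vmeet x y <=v w.
Proof.
move=> w0; rewrite vle_subC vmeet_glb !vle_subl vmeet_ler andbT.
by apply: vle_trans (vmeet_lel _ _) _; rewrite vle_addr.
Qed.

End VectorLattice.

(** * Decompositions along a couple *)

Section Splitting.
Variables (R : realType) (V0 V1 : normedModType R) (H : lmodType R).
Variables (i0 : {linear V0 -> H}) (i1 : {linear V1 -> H}).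
Implicit Types (x y : H) (t B C : R).

(** An attained form of [K(t, x) <= B].  It is preserved by sums and nonnegative
    multiples without any approximation of infima; two arbitrary linear maps
    take the place of the embeddings, so that their roles can be exchanged. *)
Definition splits_within t x B : Prop :=
  exists (x0 : V0) (x1 : V1), x = i0 x0 + i1 x1 /\ `|x0| + t * `|x1| <= B.

Lemma splits_withinW t x B C : B <= C -> splits_within t x B -> splits_within t x C.
Proof. by move=> BC [x0 [x1 [-> h]]]; exists x0, x1; split=> //; apply: le_trans BC. Qed.

Lemma splits_within0 t : splits_within t 0 0.
Proof. by exists 0, 0; rewrite !linear0 !normr0 addr0 mulr0 addr0. Qed.

Lemma splits_within0l t v : splits_within t (i0 v) `|v|.
Proof. by exists v, 0; rewrite linear0 normr0 mulr0 !addr0. Qed.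

Lemma splits_within0r t v : splits_within t (i1 v) (t * `|v|).
Proof. by exists 0, v; rewrite linear0 normr0 !add0r. Qed.

Lemma splits_withinD t x y B C : 0 <= t ->
  splits_within t x B -> splits_within t y C -> splits_within t (x + y) (B + C).
Proof.
move=> t0 [x0 [x1 [-> hx]]] [y0 [y1 [-> hy]]].
exists (x0 + y0), (x1 + y1); split; first by rewrite !linearD addrACA.
apply: le_trans (lerD hx hy); rewrite addrACA -mulrDr.
by rewrite lerD ?ler_normD ?ler_wpM2l ?ler_normD.
Qed.

Lemma splits_withinZ t x B w : 0 <= w ->
  splits_within t x B -> splits_within t (w *: x) (w * B).
Proof.
move=> w0 [x0 [x1 [-> hx]]]; exists (w *: x0), (w *: x1).
split; first by rewrite !linearZ scalerDr.
rewrite !normrZ !ger0_norm// mulrCA -mulrDr; exact: ler_wpM2l.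
Qed.

Lemma splits_within_sum t (x : nat -> H) (B : nat -> R) n : 0 <= t ->
  (forall k, splits_within t (x k) (B k)) ->
  splits_within t (\sum_(k < n) x k) (\sum_(k < n) B k).
Proof.
move=> t0 h; elim: n => [|n IH]; first by rewrite !big_ord0; apply: splits_within0.
by rewrite !big_ord_recr /=; apply: splits_withinD.
Qed.

End Splitting.

(** [K(t, x; X_0, X_1) = t K(1/t, x; X_1, X_0)]. *)
Lemma splits_within_swap (R : realType) (V0 V1 : normedModType R) (H : lmodType R)
    (i0 : {linear V0 -> H}) (i1 : {linear V1 -> H}) (t : R) (x : H) B :
  0 < t -> splits_within i1 i0 t^-1 x B -> splits_within i0 i1 t x (t * B).
Proof.
move=> t0 [x1 [x0 [-> h]]]; exists x0, x1; split; first by rewrite addrC.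
have := h; rewrite -(ler_pM2l t0) mulrDr mulrA divff ?gt_eqF// mul1r.
by rewrite addrC.
Qed.

Section Couple.
Variables (R : realType) (X : banach_lattice_couple R).
Implicit Types (x y z : ambient X) (t B : R).

Local Notation splits := (splits_within (emb0 X) (emb1 X)).

Lemma splits_within_sigma t x B : splits t x B -> sigma_space X x.
Proof. by case=> x0 [x1 [-> _]]; exists x0, x1. Qed.

Lemma K_functional_le t x B : 0 <= t -> splits t x B -> K_functional X t x <= B.
Proof.
move=> t0 [x0 [x1 [xE h]]]; apply: le_trans h; apply: ge_inf; last by exists x0, x1.
by exists 0 => _ [y0 [y1 [_ ->]]]; rewrite addr_ge0 ?mulr_ge0.
Qed.

Lemma K_functional_lt_splits t x B : 0 <= t -> sigma_space X x ->
  K_functional X t x < B -> splits t x B.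
Proof.
move=> t0 [x0 [x1 xE]] /inf_lt[|].
  by exists (`|x0| + t * `|x1|), x0, x1.
by move=> _ [y0 [y1 [yE ->]]] /ltW h; exists y0, y1.
Qed.

Lemma sigma_normE x : sigma_norm X x = K_functional X 1 x.
Proof.
by congr inf; apply/seteqP; split=> _ [x0 [x1 [-> ->]]]; exists x0, x1; rewrite mul1r.
Qed.

Lemma emb_ge0 (E F : vectorLatticeType R) (f : {linear E -> F}) (p : E) :
  interval_preserving f -> 0 <=v p -> 0 <=v f p.
Proof.
move=> fI p0; suff: [set z | (0 <=v z) && (z <=v f p)] (f p) by case/andP.
by rewrite -fI//; exists p => //=; rewrite p0 vle_refl.
Qed.

Lemma vabs_emb_le (E F : vectorLatticeType R) (f : {linear E -> F}) (p : E) :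
  interval_preserving f -> f p <=v f (vabs p) /\ - f p <=v f (vabs p).
Proof.
move=> fI.
have fB q : q <=v vabs p -> f q <=v f (vabs p).
  move=> qp; rewrite -vsub_ge0.
  have <- : f (vabs p - q) = f (vabs p) - f q by rewrite linearB.
  by rewrite emb_ge0// vsub_ge0.
split; first exact: fB (vle_abs p).
have <- : f (- p) = - f p by rewrite linearN.
exact: fB (vleN_abs p).
Qed.

(** Interval preservation is what makes the image an ideal: it provides the
    preimage of [z], and the lattice norm bounds that preimage. *)
Lemma emb_solid (E : banachLatticeType R) (F : vectorLatticeType R)
    (f : {linear E -> F}) (p : E) (z : F) :
  interval_preserving f -> 0 <=v z -> z <=v f (vabs p) ->
  exists2 q, f q = z & `|q| <= `|p|.
Proof.
move=> fI z0 zp.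
have : [set z | (0 <=v z) && (z <=v f (vabs p))] z by rewrite /= z0.
rewrite -fI ?vabs_ge0// => -[q /= /andP[q0 qp] qz].
exists q => //; apply: lattice_norm; rewrite /vabs vjoin_lub qp /=.
apply: vle_trans (vabs_ge0 p).
by rewrite -[- q]add0r vle_subl add0r.
Qed.

(** The K-functional is a lattice seminorm.  If [x = p + q] then [|x|] is at most
    [|p| + |q|], and the Riesz decomposition of [z] along this sum is
    [z = z /\ |p| + (z - z /\ |p|)]. *)
Lemma splits_within_solid t x z B : 0 <= t ->
  0 <=v z -> z <=v vabs x -> splits t x B -> splits t z B.
Proof.
move=> t0 z0 zx [p [q [xE h]]].
have I0 := @emb0_interval_preserving _ X; have I1 := @emb1_interval_preserving _ X.
have [p1 p2] := vabs_emb_le p I0; have [q1 q2] := vabs_emb_le q I1.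
have zpq : z <=v emb0 X (vabs p) + emb1 X (vabs q).
  apply: vle_trans zx _; rewrite /vabs vjoin_lub xE opprD.
  by rewrite !vleD.
have P0 := emb_ge0 I0 (vabs_ge0 p).
have Q0 := emb_ge0 I1 (vabs_ge0 q).
set P := emb0 X (vabs p) in zpq P0; set Q := emb1 X (vabs q) in zpq Q0.
have zP0 : 0 <=v vmeet z P by rewrite vmeet_glb z0.
have [p' p'E p'p] := emb_solid I0 zP0 (vmeet_ler z P).
have zQ0 : 0 <=v z - vmeet z P by rewrite vsub_ge0 vmeet_lel.
have zQ : z - vmeet z P <=v Q by apply: vsub_meet_le => //; rewrite vle_subl addrC.
have [q' q'E q'q] := emb_solid I1 zQ0 zQ.
exists p', q'; split; first by rewrite p'E q'E addrC subrK.
by apply: le_trans h; rewrite lerD// ler_wpM2l.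
Qed.

End Couple.

(** * Sparse chains of dyadic points *)

Section GreedyChain.
Variables (R : realType) (f : nat -> R).
Local Notation g j := (f j / 2 ^+ j).
Hypothesis f_gt0 : forall j, 0 < f j.
Hypothesis f_homo : forall i j, (i <= j)%N -> f i <= f j.
Hypothesis g_homo : forall i j, (i <= j)%N -> g j <= g i.

Let pow2_gt0 j : 0 < 2 ^+ j :> R. Proof. exact: exprn_gt0. Qed.

Let f_double j : f j.+1 <= 2 * f j.
Proof.
have := g_homo (leqnSn j); rewrite exprS ler_pdivrMr ?mulr_gt0//.
by rewrite (mulrC 2) mulrA divfK ?gt_eqF// mulrC.
Qed.

Let g_halve j : g j <= 2 * g j.+1.
Proof.
rewrite exprS invfM mulrCA mulVKf ?pnatr_eq0//.
by rewrite ler_pM2r ?invr_gt0// f_homo.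
Qed.

Definition well_separated i j := (4 * f i <= f j) && (4 * g j <= g i).

(** The next point [s'] of the chain is the first one that is well separated from
    [s], and the cut [d'] is the first index at which [f] has grown by the factor 4.
    Consecutive dyadic values of [f] and of [g] differ at most by the factor 2, so
    minimality of [d'] gives the bound on [f d'].  At [s'] either [s' = d'] or the
    condition on [g] was still violated one index earlier, which gives the bound on
    [g d'].  Between two cuts, [f] and [g] are therefore both controlled by their
    values at the chain point that lies in between. *)
Lemma well_separated_next s d : (d <= s)%N -> g d <= 8 * g s ->
  (exists i, well_separated s i) ->
  exists s' d', [/\ (s <= s')%N /\ (d <= d' <= s')%N, f d' <= 8 * f s,
    well_separated s s' & g d' <= 8 * g s'].
Proof.
move=> ds gds far; case: (ex_minnP far) => s' /andP[fs' gs'] s'min.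
have fex : exists i, 4 * f s <= f i by exists s'.
case: (ex_minnP fex) => o fo omin.
have fs := f_gt0 s.
have so : (s < o)%N.
  by rewrite ltnNge; apply/negP => /f_homo; lra.
have os' : (o <= s')%N by apply: omin.
exists s', o; split.
- by rewrite os' (leq_trans (ltnW so) os') (leq_trans ds (ltnW so)).
- case: o so fo omin {os'} => // o so fo omin.
  have := f_double o; case: (lerP (4 * f s) (f o)) => [/omin|]; last lra.
  by rewrite ltnn.
- by rewrite /well_separated fs'.
- have gs'0 : 0 < g s' by rewrite divr_gt0.
  move: os'; rewrite leq_eqVlt => /predU1P[->|]; first lra.
  case: s' fs' gs' s'min gs'0 => // s' fs' gs' s'min gs'0; rewrite ltnS => os'.
  have fos : 4 * f s <= f s' := le_trans fo (f_homo os').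
  have := g_halve s'; have := g_homo (ltnW so).
  case: (lerP (4 * g s') (g s)) => [h|]; last lra.
  by have /s'min : (4 * f s <= f s') && (4 * g s' <= g s) by [rewrite fos h]; rewrite ltnn.
Qed.

(** When no later point is well separated, the chain stays at its last point
    forever. *)
Lemma greedy_chain : exists s d : nat -> nat,
  [/\ s 0%N = 0%N /\ d 0%N = 0%N,
    forall k, [/\ (s k <= s k.+1)%N, (d k <= d k.+1)%N, (d k <= s k)%N &
      g (d k) <= 8 * g (s k)],
    forall k, well_separated (s k) (s k.+1) -> f (d k.+1) <= 8 * f (s k) &
    forall k, (well_separated (s k) (s k.+1)) \/
      [/\ forall i, ~~ well_separated (s k) i, s k.+1 = s k & d k.+1 = d k]].
Proof.
(* the invariant that a step from the chain point and cut [p] needs *)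
pose inv (p : nat * nat) := (p.2 <= p.1)%N /\ g p.2 <= 8 * g p.1.
have stepP (p : nat * nat) : exists q : nat * nat, inv p ->
  [/\ inv q, (p.1 <= q.1)%N, (p.2 <= q.2)%N,
    well_separated p.1 q.1 -> f q.2 <= 8 * f p.1 &
    well_separated p.1 q.1 \/
      [/\ forall i, ~~ well_separated p.1 i, q.1 = p.1 & q.2 = p.2]].
  have [pinv|] := pselect (inv p); last by exists p.
  have [[i pi]|] := pselect (exists i, well_separated p.1 i).
    have [//| s' [d' [[? /andP[]] ? ? ? ? ?]]] := well_separated_next pinv.1 pinv.2.
      by exists i.
    by exists (s', d') => _; split=> //; left.
  move=> /forallNP sep; have {}sep i : ~~ well_separated p.1 i by apply/negP/sep.
  exists p => _; split=> //; last by right.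
  by move=> h; have := sep p.1; rewrite h.
have [step stepE] := choice stepP.
pose c k := iter k step (0%N, 0%N).
have cinv k : inv (c k).
  elim: k => [|k /stepE[]//]; rewrite /c /inv /=; split=> //.
  by have := f_gt0 0%N; rewrite expr0 divr1; lra.
exists (fun k => (c k).1), (fun k => (c k).2); split=> // k;
  have [inv' ? ? ? ?] := stepE _ (cinv k) => //.
by split=> //; have [] := cinv k.
Qed.

End GreedyChain.

(** * Quasiconcave functions and their masses *)

Section Mass.
Variables (R : realType).
Implicit Types (phi : R -> R) (tau : nat -> R) (s t : R).

(** Up to a factor 2 these are the concave functions.  Unlike the cone [Conv], they
    are visibly stable under [phi |-> t phi(1/t)]; the value at 0 is left out. *)
Definition quasiconcave phi : Prop :=
  (forall t, 0 < t -> 0 <= phi t) /\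
  (forall s t, 0 < s -> s <= t -> phi s <= phi t /\ phi t / t <= phi s / s).

Definition prev_value phi tau k := if k is k'.+1 then phi (tau k') else 0.

(** The first entry vanishes when [phi] is constant from [tau_(k-1)] to [tau_k], the
    second one when [phi] is proportional to [t] from [tau_k] to [tau_(k+1)].  Each of
    the two entries telescopes in a suitable range of [k]; their minimum does in both,
    and by [node_mass_lower] it still exceeds an expression that is linear in [phi]. *)
Definition node_mass phi tau k : R :=
  Num.min (phi (tau k) - prev_value phi tau k)
          (phi (tau k) - tau k * (phi (tau k.+1) / tau k.+1)).

Variables (phi : R -> R) (tau : nat -> R).
Hypotheses (phiQ : quasiconcave phi) (tau_gt0 : forall k, 0 < tau k).
Hypothesis tau_homo : forall k, tau k <= tau k.+1.

Let prev_ge0 k : 0 <= prev_value phi tau k.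
Proof. by case: k => //= k; apply: phiQ.1. Qed.

Lemma node_mass_ge0 k : 0 <= node_mass phi tau k.
Proof.
have [p0 pm] := phiQ; rewrite le_min !subr_ge0; apply/andP; split.
  by case: k => [|k] /=; [exact: p0 | have [] := pm _ _ (tau_gt0 k) (tau_homo k)].
rewrite mulrC -ler_pdivlMr//.
by have [] := pm _ _ (tau_gt0 k) (tau_homo k).
Qed.

Lemma node_mass_lower k : phi (tau k) - prev_value phi tau k
  - tau k * (phi (tau k.+1) / tau k.+1) <= node_mass phi tau k.
Proof.
have P0 := prev_ge0 k.
have D0 : 0 <= tau k * (phi (tau k.+1) / tau k.+1).
  by rewrite mulr_ge0 ?divr_ge0 ?(ltW (tau_gt0 _))// phiQ.1.
by rewrite /node_mass le_min; apply/andP; split; lra.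
Qed.

(** For the [k] with [tau_k <= t] the first entry of the minimum telescopes to at most
    [phi t], and for the other ones the second entry telescopes to at most
    [t (phi t / t)].  Truncating the values at [phi t] and the slopes at [phi t / t]
    makes both estimates hold for all [k] at once. *)
Lemma node_mass_sum t K : 0 < t ->
  \sum_(k < K) node_mass phi tau k * Num.min 1 (t / tau k) <= 2 * phi t.
Proof.
move=> t0; have [p0 pm] := phiQ.
pose U k := if k is k'.+1 then Num.min (phi (tau k')) (phi t) else 0.
pose D k := Num.min (phi (tau k) / tau k) (phi t / t).
have step k : node_mass phi tau k * Num.min 1 (t / tau k) <=
    (U k.+1 - U k) + t * (D k - D k.+1).
  have tk := tau_gt0 k; have [pk dk] := pm _ _ tk (tau_homo k).
  have D0 : 0 <= D k - D k.+1.
    by rewrite subr_ge0 /D le_min !ge_min lexx dk !orbT.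
  have U0 : 0 <= U k.+1 - U k.
    rewrite subr_ge0 /U; case: (k) => [|j]; first by rewrite le_min !p0.
    by rewrite le_min !ge_min lexx !orbT (pm _ _ (tau_gt0 j) (tau_homo j)).1.
  case: (leP (tau k) t) => kt.
    apply: (@le_trans _ _ (node_mass phi tau k)).
      by rewrite ler_piMr ?node_mass_ge0// ge_min lexx.
    apply: (@le_trans _ _ (U k.+1 - U k)); last by rewrite lerDl mulr_ge0// ltW.
    rewrite /node_mass ge_min; apply/orP; left.
    rewrite /U min_l ?(pm _ _ tk kt).1//; case: (k) (kt) => //= j jt.
    rewrite min_l// (pm _ _ (tau_gt0 j) _).1//; exact: le_trans jt.
  apply: (@le_trans _ _ (t * (D k - D k.+1))); last by rewrite lerDr.
  have {}kt := ltW kt.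
  apply: (@le_trans _ _ (node_mass phi tau k * (t / tau k))).
    by rewrite ler_wpM2l ?node_mass_ge0// ge_min lexx orbT.
  rewrite mulrCA ler_wpM2l ?(ltW t0)// ler_pdivrMr//.
  rewrite /node_mass ge_min; apply/orP; right.
  rewrite /D !min_l ?(pm _ _ t0 _).2 ?(le_trans kt)//.
  by rewrite mulrBl divfK ?gt_eqF// (mulrC (tau k)).
have : \sum_(k < K) node_mass phi tau k * Num.min 1 (t / tau k) <= U K + t * (D 0%N - D K).
  elim: K => [|K IH]; first by rewrite big_ord0 /U subrr mulr0 addr0.
  rewrite big_ord_recr; apply: le_trans (lerD IH (step K)) _.
  move: (U K) (U K.+1) (D 0%N) (D K) (D K.+1) => a b c e h; lra.
move/le_trans; apply; rewrite mulr_natl mulr2n lerD//.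
  by rewrite /U; case: (K) => [|j]; [exact: p0 | rewrite ge_min lexx orbT].
rewrite mulrC -ler_pdivlMr// lerBlDr /D.
apply: (@le_trans _ _ (phi t / t)); first by rewrite ge_min lexx orbT.
by rewrite lerDl le_min !divr_ge0 ?p0 ?(ltW t0) ?(ltW (tau_gt0 _)).
Qed.

End Mass.

(** Only finitely many weights are nonzero: this keeps the infinite sums over the
    pieces and over the functions from interacting. *)
Lemma proportional_weights (R : realType) (m : nat -> R) N (B C : R) :
  (forall n, 0 <= m n) -> 0 < B -> B <= C * \sum_(n < N) m n ->
  exists w : nat -> R, [/\ forall n, 0 <= w n,
    forall M, (N <= M)%N -> \sum_(n < M) w n = 1 & forall n, w n * B <= C * m n].
Proof.
move=> m0; set S := \sum_(n < N) m n => B0 BCS.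
have S0 : 0 <= S by apply: sumr_ge0.
have SN0 : 0 < S.
  rewrite lt_def S0 andbT; apply/eqP => S00.
  by move: BCS; rewrite S00 mulr0; lra.
have C0 : 0 < C by rewrite -(pmulr_lgt0 _ SN0); apply: lt_le_trans BCS.
exists (fun n => if (n < N)%N then m n / S else 0); split.
- by move=> n; case: ifP => // _; rewrite divr_ge0.
- move=> M NM; rewrite -(big_mkord xpredT (fun n => if (n < N)%N then m n / S else 0)).
  rewrite (big_cat_nat _ NM)//= [X in _ + X]big_nat_cond [X in _ + X]big1 ?addr0.
    rewrite big_mkord (eq_bigr (fun n : 'I_N => m n / S)) => [|n _];
      last by rewrite ltn_ord.
    by rewrite -mulr_suml divff// gt_eqF.
  by move=> n; rewrite andbT => /andP[]; rewrite leqNgt => /negbTE->.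
- move=> n; case: ifP => _; last by rewrite mul0r mulr_ge0// ltW.
  by rewrite mulrAC ler_pdivrMr// -mulrA mulrCA ler_wpM2l// mulrC // mulrC.
Qed.

(** * Distributing an absolutely convergent series *)

Section Rearrangement.
Variables (R : realType) (V : completeNormedModType R).
Implicit Types (u : nat -> V) (w : nat -> nat -> R).

Lemma absolutely_cvg u (T : R) : (forall K, \sum_(k < K) `|u k| <= T) ->
  cvgn (fun K => \sum_(k < K) u k).
Proof.
move=> uT; rewrite -[X in cvgn X](seriesEord u); apply: normed_cvg.
rewrite /normed_series_of seriesEord.
apply: nondecreasing_is_cvgn; last by exists T => _ [K _ <-]; apply: uT.
apply/nondecreasing_seqP => K /=.
by rewrite big_ord_recr/= lerDl.
Qed.

Lemma cvg_norm_le (a : nat -> V) (l : V) (c : R) :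
  a n @[n --> \oo] --> l -> (forall n, `|a n| <= c) -> `|l| <= c.
Proof.
move=> al ac; have nl : `|a n| @[n --> \oo] --> `|l| by apply: cvg_norm.
apply: (ler_cvg_to nl (cvg_cst c)).
by near=> n; apply: ac.
Unshelve. all: by end_near. Qed.

Lemma cvg_finite_sum (I : nat) (a : nat -> nat -> V) (l : nat -> V) :
  (forall n, a n K @[K --> \oo] --> l n) ->
  \sum_(n < I) a n K @[K --> \oo] --> \sum_(n < I) l n.
Proof.
move=> al; elim: I => [|I IH].
  by rewrite big_ord0; under eq_fun do rewrite big_ord0; exact: cvg_cst.
by rewrite big_ord_recr; under eq_fun do rewrite big_ord_recr; apply: cvgD.
Qed.

(** Tannery's theorem: distributing each term of an absolutely convergent series by
    weights of total mass 1 does not change the sum. *)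
Lemma sum_rearrangement u w (T : R) (b : V) :
  (forall K, \sum_(k < K) `|u k| <= T) ->
  \sum_(k < K) u k @[K --> \oo] --> b ->
  (forall k n, 0 <= w k n) ->
  (forall k, exists N, forall M, (N <= M)%N -> \sum_(n < M) w k n = 1) ->
  exists y : nat -> V,
    (forall n, \sum_(k < K) w k n *: u k @[K --> \oo] --> y n) /\
    \sum_(n < M) y n @[M --> \oo] --> b.
Proof.
move=> uT ub w0 w1.
have [N wN] := choice w1.
have Wle1 M k : \sum_(n < M) w k n <= 1.
  rewrite -(wN k (maxn M (N k))) ?leq_maxr//.
  rewrite (big_ord_widen _ (fun n => w k n) (leq_maxl M (N k))) big_mkcond.
  by apply: ler_sum => n _; case: ifP.
have wle1 k n : w k n <= 1.
  by apply: le_trans (Wle1 n.+1 k); rewrite big_ord_recr lerDr sumr_ge0.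
have ycvg n : cvgn (fun K => \sum_(k < K) w k n *: u k).
  apply: (@absolutely_cvg (fun k => w k n *: u k) T) => K; apply: le_trans (uT K).
  by apply: ler_sum => k _; rewrite normrZ ger0_norm// ler_piMl.
pose y n := limn (fun K => \sum_(k < K) w k n *: u k).
exists y; split; first exact: ycvg.
pose W M k := \sum_(n < M) w k n.
have dcvg M : \sum_(k < K) (1 - W M k) *: u k @[K --> \oo] --> b - \sum_(n < M) y n.
  have -> : (fun K => \sum_(k < K) (1 - W M k) *: u k) =
      (fun K => \sum_(k < K) u k - \sum_(n < M) \sum_(k < K) w k n *: u k).
    apply/funext => K; rewrite exchange_big -sumrB; apply: eq_bigr => k _ /=.
    by rewrite -scaler_suml scalerBl scale1r.
  apply: cvgB => //.
  exact: (@cvg_finite_sum M (fun n K => \sum_(k < K) w k n *: u k) y ycvg).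
have [e0 uT0] : exists e0 : R, (forall K, \sum_(k < K) `|u k| <= e0) /\
    (forall e, 0 < e -> exists K, e0 - e < \sum_(k < K) `|u k|).
  have S : has_sup (range (fun K => \sum_(k < K) `|u k|)).
    by split; [exists (\sum_(k < 0) `|u k|), 0%N | exists T => _ [K _ <-]].
  exists (sup (range (fun K => \sum_(k < K) `|u k|))); split=> [K|e e0].
    by apply: ub_le_sup; [case: S | exists K].
  by have [_ [K _ <-] h] := sup_adherent e0 S; exists K.
apply/cvgrPdist_le => e epos.
(* the norms beyond [Kc] sum up to at most [e]; the terms before [Kc] are completely
   distributed as soon as [M] exceeds finitely many thresholds *)
have [Kc /ltW Kce] := uT0.2 _ epos.
near=> M.
have WM1 k : (k < Kc)%N -> W M k = 1.
  move=> kK; apply: wN.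
  apply: (@leq_trans (\max_(k < Kc) N k)); last by near: M; exists (\max_(k < Kc) N k).
  exact: (leq_bigmax (Ordinal kK)).
apply: cvg_norm_le (dcvg M) _ => K.
apply: le_trans (ler_norm_sum _ _ _) _.
have W0 k : 0 <= 1 - W M k by rewrite subr_ge0 Wle1.
have tE k : `|(1 - W M k) *: u k| = (1 - W M k) * `|u k| by rewrite normrZ ger0_norm.
under eq_bigr do rewrite tE.
have head j : (j <= Kc)%N -> \sum_(k < j) (1 - W M k) * `|u k| = 0.
  move=> jK; rewrite big1// => k _.
  by rewrite WM1 ?subrr ?mul0r// (leq_trans (ltn_ord k)).
case: (leqP K Kc) => [/head->|/ltnW KcK]; first exact: ltW.
have tail j : \sum_(k < Kc + j) (1 - W M k) * `|u k| <=
    \sum_(k < Kc + j) `|u k| - \sum_(k < Kc) `|u k|.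
  elim: j => [|j IH]; first by rewrite addn0 head// subrr.
  rewrite addnS !big_ord_recr /= addrAC lerD// ler_piMl// lerBlDr lerDl.
  by apply: sumr_ge0.
rewrite -(subnKC KcK); apply: le_trans (tail _) _.
by have := uT0.1 (Kc + (K - Kc))%N; move: Kce; lra.
Unshelve. all: by end_near. Qed.

End Rearrangement.

(** * Sums of quasiconcave functions *)

Section Total.
Variables (R : realType) (phi : nat -> R -> R) (F : R -> R).
Hypothesis phiQ : forall n, quasiconcave (phi n).
Hypothesis phiF : forall t : R, 0 < t -> \sum_(n < N) phi n t @[N --> \oo] --> F t.

Lemma total_ge t N : 0 < t -> \sum_(n < N) phi n t <= F t.
Proof.
move=> t0; rewrite -(cvg_lim _ (phiF t0))//.
apply: (@nondecreasing_cvgn_le _ (fun N => \sum_(n < N) phi n t)); last first.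
  by apply/cvg_ex; exists (F t); apply: phiF.
by apply/nondecreasing_seqP => n; rewrite big_ord_recr lerDl; apply: (phiQ _).1.
Qed.

Lemma total_approx t c : 0 < t -> c < F t -> exists N, c < \sum_(n < N) phi n t.
Proof.
by move=> t0 cF; have [N _ h] := cvgr_gt _ (phiF t0) _ cF; exists N; apply: h => /=.
Qed.

Lemma total_quasiconcave : quasiconcave F.
Proof.
split=> [t t0|s t s0 st]; first by have := total_ge 0 t0; rewrite big_ord0.
have t0 : 0 < t := lt_le_trans s0 st.
split.
  apply: (ler_cvg_to (phiF s0) (phiF t0)); near=> N.
  by apply: ler_sum => n _; have [] := (phiQ n).2 _ _ s0 st.
have quot r : 0 < r -> (\sum_(n < N) phi n r) / r @[N --> \oo] --> F r / r.
  by move=> r0; apply: cvgMr_tmp; apply: phiF.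
apply: (ler_cvg_to (quot _ t0) (quot _ s0)); near=> N.
by rewrite !mulr_suml; apply: ler_sum => n _; have [] := (phiQ n).2 _ _ s0 st.
Unshelve. all: by end_near. Qed.

(** [beta n] is the slope of [phi n] at infinity.  Slopes are additive even for the
    infinite sum, because [phi n t / t <= phi n 1] for [t >= 1] dominates the tail. *)
Lemma slope_mass c : 0 < c -> (forall j, c <= F (2 ^+ j) / 2 ^+ j) ->
  exists (beta : nat -> R) (N : nat), [/\ forall n, 0 <= beta n,
    forall n t, 0 < t -> beta n * t <= phi n t & c / 2 <= \sum_(n < N) beta n].
Proof.
move=> c0 cF.
have p0 j : 0 < 2 ^+ j :> R by apply: exprn_gt0.
have p_homo i j : (i <= j)%N -> 2 ^+ i <= 2 ^+ j :> R.
  by move=> ij; rewrite ler_weXn2l// ler1n.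
pose q n j := phi n (2 ^+ j) / 2 ^+ j.
have q0 n j : 0 <= q n j by rewrite divr_ge0 ?(phiQ n).1// ltW.
have q_homo n : {homo q n : i j / (i <= j)%N >-> j <= i}.
  by move=> i j ij; have [] := (phiQ n).2 _ _ (p0 i) (p_homo _ _ ij).
have q_cvg n : cvgn (q n).
  by apply: nonincreasing_is_cvgn => //; exists 0 => _ [j _ <-].
pose beta n := limn (q n).
have bq n j : beta n <= q n j by apply: nonincreasing_cvgn_ge.
have [|N hN] := @total_approx 1 (F 1 - c / 2) ltr01; first by lra.
exists beta, N; split.
- by move=> n; apply: limr_ge => //; near=> j.
- move=> n t t0.
  pose j := Num.bound t.
  have tj : t <= 2 ^+ j.
    apply: le_trans (ltW (archi_boundP (ltW t0))) _.
    by rewrite -natrX ler_nat ltnW// ltn_expl.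
  rewrite -ler_pdivlMr//; apply: le_trans (bq n j) _.
  by have [] := (phiQ n).2 _ _ t0 tj.
- (* by monotonicity in [M], the tail of the slopes at [2 ^+ j] is at most the tail of
     the values at 1, which is at most [c / 2] *)
  have qsum j : c / 2 <= \sum_(n < N) q n j.
    have dQ M : \sum_(n < M) (phi n 1 - q n j) =
        \sum_(n < M) phi n 1 - (\sum_(n < M) phi n (2 ^+ j)) / 2 ^+ j.
      by rewrite sumrB mulr_suml.
    have dcvg : \sum_(n < M) (phi n 1 - q n j) @[M --> \oo] --> F 1 - F (2 ^+ j) / 2 ^+ j.
      under eq_fun do rewrite dQ.
      by apply: cvgB; [exact: phiF | apply: cvgMr_tmp; exact: phiF].
    have : \sum_(n < N) (phi n 1 - q n j) <= F 1 - F (2 ^+ j) / 2 ^+ j.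
      rewrite -(cvg_lim _ dcvg)//.
      apply: (@nondecreasing_cvgn_le _ (fun M => \sum_(n < M) (phi n 1 - q n j))).
        apply/nondecreasing_seqP => n; rewrite big_ord_recr lerDl subr_ge0.
        by have := q_homo n 0%N j (leq0n j); rewrite /q expr0 divr1.
      by apply/cvg_ex; eexists; exact: dcvg.
    rewrite sumrB; have := cF j; move: hN; lra.
  have sc : \sum_(n < N) q n j @[j --> \oo] --> \sum_(n < N) beta n.
    exact: (@cvg_finite_sum R R^o N q beta q_cvg).
  by apply: (ler_cvg_to (cvg_cst _) sc); near=> j.
Unshelve. all: by end_near. Qed.

(** The neighbouring values of [F] together take away half of [F (tau k)], and a
    partial sum up to [N] gives up another quarter. *)
Lemma node_mass_total tau k : (forall k, 0 < tau k) -> (forall k, tau k <= tau k.+1) ->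
  0 < F (tau k) -> 4 * prev_value F tau k <= F (tau k) ->
  4 * (F (tau k.+1) / tau k.+1) <= F (tau k) / tau k ->
  exists N, F (tau k) <= 4 * \sum_(n < N) node_mass (phi n) tau k.
Proof.
move=> tau0 tau_homo F0 Fprev Fnext.
have [|N hN] := @total_approx (tau k) (3 / 4 * F (tau k)) (tau0 k); first by lra.
exists N.
have lower : \sum_(n < N) (phi n (tau k) - prev_value (phi n) tau k
    - tau k * (phi n (tau k.+1) / tau k.+1)) <= \sum_(n < N) node_mass (phi n) tau k.
  by apply: ler_sum => n _; apply: node_mass_lower.
move: lower; rewrite !sumrB -mulr_sumr -mulr_suml.
have : \sum_(n < N) prev_value (phi n) tau k <= prev_value F tau k.
  by case: (k) => [|j] /=; [rewrite big1 | apply: total_ge].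
have : tau k * ((\sum_(n < N) phi n (tau k.+1)) / tau k.+1) <= F (tau k) / 4.
  rewrite mulrC -ler_pdivlMr// mulrAC ler_pdivlMr//.
  apply: le_trans Fnext; rewrite mulrC ler_wpM2l//.
  by rewrite ler_wpM2r ?invr_ge0 ?(ltW (tau0 _))//; exact: total_ge.
lra.
Qed.

End Total.

(** * Dividing the component in the second space *)

Section RightHalf.
Variables (R : realType) (V0 : normedModType R) (V1 : completeNormedModType R).
Variables (H : lmodType R) (i0 : {linear V0 -> H}) (i1 : {linear V1 -> H}).
Variables (phi : nat -> R -> R) (F : R -> R).
Hypothesis phiQ : forall n, quasiconcave (phi n).
Hypothesis phiF : forall t : R, 0 < t -> \sum_(n < N) phi n t @[N --> \oo] --> F t.
Hypothesis F_gt0 : forall t : R, 0 < t -> 0 < F t.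
Variables (x : H) (a : nat -> V0) (b : nat -> V1).
Hypothesis xE : forall j, x = i0 (a j) + i1 (b j).
Hypothesis a_le : forall j, `|a j| <= 2 * F (2 ^+ j).
Hypothesis b_le : forall j, 2 ^+ j * `|b j| <= 2 * F (2 ^+ j).

Local Notation f j := (F (2 ^+ j)).
Local Notation g j := (F (2 ^+ j) / 2 ^+ j).
Local Notation splits := (splits_within i0 i1).

Let p_gt0 j : 0 < 2 ^+ j :> R. Proof. exact: exprn_gt0. Qed.

Let p_homo i j : (i <= j)%N -> 2 ^+ i <= 2 ^+ j :> R.
Proof. by move=> ij; rewrite ler_weXn2l// ler1n. Qed.

Let FQ : quasiconcave F. Proof. exact: total_quasiconcave phiF. Qed.

Let f_gt0 j : 0 < f j. Proof. exact: F_gt0. Qed.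

Let f_homo i j : (i <= j)%N -> f i <= f j.
Proof. by move=> ij; have [] := FQ.2 _ _ (p_gt0 i) (p_homo ij). Qed.

Let g_homo i j : (i <= j)%N -> g j <= g i.
Proof. by move=> ij; have [] := FQ.2 _ _ (p_gt0 i) (p_homo ij). Qed.

Let g_gt0 j : 0 < g j. Proof. by rewrite divr_gt0. Qed.

Let b_le' j : `|b j| <= 2 * g j.
Proof. by rewrite mulrA ler_pdivlMr// mulrC. Qed.

Let i1_diff i j : i1 (b i - b j) = i0 (a j - a i).
Proof.
rewrite !linearB; apply/eqP; rewrite subr_eq addrAC eq_sym subr_eq.
by rewrite -xE addrC -xE.
Qed.

Let scale_i1 (w : R) v : w *: i1 v = i1 (w *: v). Proof. by rewrite linearZ. Qed.

Let splits_min t v s B : 0 < t ->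
  splits t (i1 v) B -> t * `|v| <= B / 2 ^+ s * t ->
  splits t (i1 v) (B * Num.min 1 (t / 2 ^+ s)).
Proof.
move=> t0 h1 h2; case: (leP 1 (t / 2 ^+ s)) => _; first by rewrite mulr1.
apply: splits_withinW (splits_within0r _ _ _ _).
by rewrite mulrA mulrAC.
Qed.

(** A piece is shared in proportion to the masses [m n], and every share keeps the
    profile [e] of the whole piece. *)
Lemma weighted_piece (v : V1) (B C : R) (e : R -> R) (m : nat -> R) N :
  (forall n, 0 <= m n) -> 0 < B -> B <= C * \sum_(n < N) m n ->
  (forall t, 0 < t -> 0 <= e t /\ splits t (i1 v) (B * e t)) ->
  exists w : nat -> R, [/\ forall n, 0 <= w n,
    exists N, forall M, (N <= M)%N -> \sum_(n < M) w n = 1 &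
    forall n t, 0 < t -> splits t (i1 (w n *: v)) (C * (m n * e t))].
Proof.
move=> m0 B0 BC hv; have [w [w0 w1 wB]] := proportional_weights m0 B0 BC.
exists w; split=> //; first by exists N.
move=> n t t0; have [e0 hs] := hv t t0.
rewrite -scale_i1; apply: splits_withinW (splits_withinZ (w0 n) hs).
by rewrite !mulrA ler_wpM2r.
Qed.

Lemma zero_piece (B : nat -> R -> R) : (forall n t, 0 < t -> 0 <= B n t) ->
  exists w : nat -> R, [/\ forall n, 0 <= w n,
    exists N, forall M, (N <= M)%N -> \sum_(n < M) w n = 1 &
    forall n t, 0 < t -> splits t (i1 (w n *: 0)) (B n t)].
Proof.
move=> B0; exists (fun n => (n == 0%N)%:R); split=> [n||n t t0].
- exact: ler0n.
- by exists 1%N => -[//|M] _; rewrite big_ord_recl big1 ?addr0.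
- by rewrite scaler0 linear0; apply: splits_withinW (splits_within0 _ _ _); apply: B0.
Qed.

Let pow2_ubound (t : R) : 0 < t -> exists i, t <= 2 ^+ i.
Proof.
move=> t0; exists (Num.bound t); apply: le_trans (ltW (archi_boundP (ltW t0))) _.
by rewrite -natrX ler_nat ltnW// ltn_expl.
Qed.

(** If no index is well separated from [s], then, by monotonicity, one and the same of
    the two growth conditions fails at every index.  If [f < 4 f s] throughout, [b d]
    is an element of the first space up to a summand [b i] with [i] large, and its
    K-functional is at most a multiple of [f s * min 1 (t / 2 ^+ s)].  Otherwise
    [g > g s / 4] throughout, and the bound [t * `|b d|] is a multiple of [t] times
    the total slope at infinity. *)
Lemma terminal_piece s d : (d <= s)%N -> g d <= 8 * g s ->
  (forall i, ~~ well_separated (fun j => f j) s i) ->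
  exists w : nat -> R, [/\ forall n, 0 <= w n,
    exists N, forall M, (N <= M)%N -> \sum_(n < M) w n = 1 &
    forall n t, 0 < t -> splits t (i1 (w n *: b d)) (128 * phi n t)].
Proof.
move=> ds gds nsep; have bd := b_le' d.
have [flat|] := pselect (forall i, f i < 4 * f s).
  pose e (t : R) := Num.min 1 (t / 2 ^+ s).
  have [|N /ltW hN] := @total_approx _ phi F phiF (2 ^+ s) (f s / 4) (p_gt0 s).
    by have := f_gt0 s; lra.
  have [n|||t t0|w [w0 w1 wB]] := @weighted_piece (b d) (24 * f s) 128 e
      (fun n => phi n (2 ^+ s)) N.
  - exact: (phiQ n).1.
  - by have := f_gt0 s; lra.
  - by have := f_gt0 s; lra.
  - split; first by rewrite le_min ler01 divr_ge0// ltW.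
    apply: splits_min => //; last first.
      rewrite mulrC ler_wpM2r ?(ltW t0)// -mulrA; have := g_gt0 s; lra.
    have [i ti] := pow2_ubound t0.
    (* [i] is chosen with [t <= 2 ^+ i], so that [t * `|b i|] is at most [2 * f i] *)
    have -> : b d = b d - b i + b i by rewrite subrK.
    rewrite linearD i1_diff.
    apply: splits_withinW (splits_withinD (ltW t0)
      (splits_within0l _ _ _ _) (splits_within0r _ _ _ _)).
    have h1 : `|a i - a d| <= 2 * f i + 2 * f d.
      by apply: le_trans (ler_normB _ _) _; rewrite lerD.
    have h2 : t * `|b i| <= 2 * f i.
      by apply: le_trans (b_le i); rewrite ler_wpM2r.
    have := flat i; have := f_homo ds; have := f_gt0 s; lra.
  exists w; split=> // n t t0; apply: splits_withinW (wB n t t0).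
  rewrite ler_pM2l//= /e; have [q0 q1] := phiQ n.
  case: (leP (2 ^+ s) t) => st.
    rewrite min_l ?mulr1; first by have [] := q1 _ _ (p_gt0 s) st.
    by rewrite ler_pdivlMr// mul1r.
  apply: (@le_trans _ _ (phi n (2 ^+ s) * (t / 2 ^+ s))).
    by rewrite ler_wpM2l ?q0// ge_min lexx orbT.
  by rewrite mulrCA mulrC -ler_pdivlMr//; have [] := q1 _ _ t0 (ltW st).
move=> /existsNP[i /negP]; rewrite -leNgt => fi.
have gs := g_gt0 s.
have steep j : g s / 4 <= g j.
  have /negP := nsep (maxn i j); rewrite /well_separated => /negP.
  rewrite negb_and -!ltNge => /orP[|].
    by have := f_homo (leq_maxl i j); move: fi; lra.
  by have := g_homo (leq_maxr i j); lra.
have [|beta [N [be0 bephi beN]]] := slope_mass phiQ phiF _ steep; first by lra.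
have [||t t0|w [w0 w1 wB]] := @weighted_piece (b d) (16 * g s) 128 id beta N be0.
- lra.
- lra.
- split; first exact: ltW.
  apply: splits_withinW (splits_within0r _ _ _ _).
  by rewrite mulrC ler_wpM2r ?(ltW t0)//; lra.
exists w; split=> // n t t0; apply: splits_withinW (wB n t t0).
by rewrite ler_pM2l//; apply: bephi.
Qed.

(** The difference [b (d k) - b (d k.+1)] is controlled in the first space by
    [f (d k.+1) <= 8 * f (s k)] and in the second one by [g (d k) <= 8 * g (s k)]: the
    cuts enclose [s k] in such a way that both bounds refer to [s k]. *)
Lemma chain_piece (s d : nat -> nat) k :
  (forall k, (s k <= s k.+1)%N) -> (forall k, (d k <= d k.+1)%N) ->
  g (d k) <= 8 * g (s k) ->
  (k = 0%N \/ exists2 j, k = j.+1 & well_separated (fun j => f j) (s j) (s k)) ->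
  well_separated (fun j => f j) (s k) (s k.+1) -> f (d k.+1) <= 8 * f (s k) ->
  exists w : nat -> R, [/\ forall n, 0 <= w n,
    exists N, forall M, (N <= M)%N -> \sum_(n < M) w n = 1 &
    forall n t, 0 < t -> splits t (i1 (w n *: (b (d k) - b (d k.+1))))
      (128 * (node_mass (phi n) (fun k => 2 ^+ s k) k * Num.min 1 (t / 2 ^+ s k)))].
Proof.
move=> s_homo d_homo gd prev next fd.
have tau0 j : 0 < 2 ^+ s j :> R by [].
have tau_homo j : 2 ^+ s j <= 2 ^+ s j.+1 :> R by apply: p_homo.
have [|||N hN] := node_mass_total phiQ phiF tau0 tau_homo (k := k).
- exact: f_gt0.
- case: prev => [->|[j -> /andP[]//]] /=; first by rewrite mulr0 ltW.
- by case/andP: next.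
have fs := f_gt0 (s k).
apply: (@weighted_piece _ (32 * f (s k)) 128 (fun t => Num.min 1 (t / 2 ^+ s k))
  (fun n => node_mass (phi n) (fun k => 2 ^+ s k) k) N) => [n|||t t0].
- exact: node_mass_ge0.
- lra.
- by move: hN; lra.
split; first by rewrite le_min ler01 divr_ge0// ltW.
apply: splits_min => //.
  rewrite i1_diff; apply: splits_withinW (splits_within0l _ _ _ _).
  apply: le_trans (ler_normB _ _) _.
  have := a_le (d k); have := a_le (d k.+1); have := f_homo (d_homo k); lra.
rewrite mulrC ler_wpM2r ?(ltW t0)//; apply: le_trans (ler_normB _ _) _.
rewrite -mulrA.
have := b_le' (d k); have := b_le' (d k.+1); have := g_homo (d_homo k); lra.
Qed.

(** The cuts [d k] decompose [b 0] into a telescoping series plus the limit [z] of the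
    [b (d k)].  This limit is 0 when the chain never stops, and [b (d K)] when it stops
    at [K].  The constant is 128 for the terminal piece plus twice 128 for the chain. *)
Lemma right_half : exists y : nat -> V1,
  \sum_(n < M) y n @[M --> \oo] --> b 0%N /\
  forall n (t e : R), 0 < t -> 0 < e -> splits t (i1 (y n)) (384 * phi n t + e).
Proof.
have [s [d [[s0 d0] sd fd next]]] := greedy_chain f_gt0 f_homo g_homo.
have s_homo k : (s k <= s k.+1)%N by case: (sd k).
have d_homo k : (d k <= d k.+1)%N by case: (sd k).
have ds k : (d k <= s k)%N by case: (sd k).
have gd k : g (d k) <= 8 * g (s k) by case: (sd k).
have tau0 j : 0 < 2 ^+ s j :> R by [].
have tau_homo j : 2 ^+ s j <= 2 ^+ s j.+1 :> R by apply: p_homo.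
pose v k := b (d k) - b (d k.+1).
pose m n k t := node_mass (phi n) (fun k => 2 ^+ s k) k * Num.min 1 (t / 2 ^+ s k).
have m0 n k t : 0 < t -> 0 <= m n k t.
  by move=> t0; rewrite mulr_ge0 ?node_mass_ge0// le_min ler01 divr_ge0// ltW.
have vpiece k : exists w : nat -> R, [/\ forall n, 0 <= w n,
    exists N, forall M, (N <= M)%N -> \sum_(n < M) w n = 1 &
    forall n t, 0 < t -> splits t (i1 (w n *: v k)) (128 * m n k t)].
  have [sep|[_ _ dk]] := next k; last first.
    rewrite /v dk subrr; apply: zero_piece => n t t0.
    by rewrite mulr_ge0// m0.
  apply: chain_piece => //; last exact: fd.
  case: (k) sep => [|j] sep; [by left | right].
  exists j => //; have [//|[nsep sj _]] := next j.
  by have := nsep (s j.+2); rewrite -sj sep.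
(* [g] drops by the factor 4, so the norms are dominated by a telescoping series *)
have vnorm k : `|v k| <= 64 * (g (s k) - g (s k.+1)).
  rewrite /v; have [/andP[_ sep]|[_ -> ->]] := next k; last by rewrite !subrr normr0 mulr0.
  apply: le_trans (ler_normB _ _) _.
  have := b_le' (d k); have := b_le' (d k.+1); have := g_homo (d_homo k); have := gd k.
  have := g_gt0 (s k); lra.
have [z [zb [wz [wz0 wz1 wzB]]]] : exists z : V1, b (d k) @[k --> \oo] --> z /\
    exists w : nat -> R, [/\ forall n, 0 <= w n,
    exists N, forall M, (N <= M)%N -> \sum_(n < M) w n = 1 &
    forall n t, 0 < t -> splits t (i1 (w n *: z)) (128 * phi n t)].
  have [[K stop]|/forallNP sep] :=
      pselect (exists K, forall i, ~~ well_separated (fun j => f j) (s K) i).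
    exists (b (d K)); split; last exact: (terminal_piece (ds K) (gd K)).
    have stay j : s (K + j)%N = s K /\ d (K + j)%N = d K.
      elim: j => [|j [IHs IHd]]; first by rewrite addn0.
      rewrite addnS; case: (next (K + j)%N) => [|[_ -> ->//]].
      by rewrite IHs => h; have := stop (s (K + j).+1); rewrite h.
    apply: cvg_near_cst; exists K => // k /= Kk.
    by rewrite -(subnKC Kk) (stay _).2.
  exists 0; split; last first.
    by apply: zero_piece => n t t0; rewrite mulr_ge0 ?(phiQ n).1.
  have gs k : g (s k) <= g 0%N * k.+1%:R^-1.
    elim: k => [|k IH]; first by rewrite s0 invr1 !mulr1.
    case: (next k) => [/andP[_ h]|[stop _ _]]; last by case: (sep k).
    have : 4 * g (s k.+1) <= g 0%N * k.+1%:R^-1 by apply: le_trans IH.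
    have g00 := ltW (g_gt0 0%N).
    have : g 0%N * k.+1%:R^-1 <= g 0%N * (2 * k.+2%:R^-1).
      rewrite ler_wpM2l// ler_pdivlMr ?ltr0n// mulrC ler_pdivrMr ?ltr0n//.
      by rewrite -natrM ler_nat; lia.
    rewrite mulrCA.
    have : 0 <= g 0%N * k.+2%:R^-1 by rewrite mulr_ge0// invr_ge0.
    move: (g 0%N * k.+1%:R^-1) (g 0%N * k.+2%:R^-1) (g (s k.+1)) => p q r; lra.
  apply/cvgr0Pnorm_le => e e0.
  have h0 : 16 * g 0%N * k.+1%:R^-1 @[k --> \oo] --> 16 * g 0%N * 0.
    by apply: cvgMl_tmp; apply: cvg_harmonic.
  rewrite mulr0 in h0.
  near=> k; apply: le_trans (b_le' (d k)) _.
  apply: (@le_trans _ _ (16 * g 0%N * k.+1%:R^-1)).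
    rewrite -mulrA; have := gd k; have := gs k.
    move: (g 0%N * k.+1%:R^-1) (g (s k)) (g (d k)) => p q r; lra.
  by near: k; apply: cvgr_le h0 _ e0.
pose u k := if k is j.+1 then v j else z.
have uT K : \sum_(k < K) `|u k| <= `|z| + 64 * g 0%N.
  have g00 := g_gt0 0%N.
  case: K => [|K]; first by rewrite big_ord0 addr_ge0// mulr_ge0// ltW.
  rewrite big_ord_recl lerD2l /=.
  have : \sum_(k < K) `|v k| <= 64 * (g (s 0%N) - g (s K)).
    elim: K => [|K IH]; first by rewrite big_ord0 subrr mulr0.
    by rewrite big_ord_recr /=; have := vnorm K; lra.
  by rewrite s0; have := g_gt0 (s K); lra.
have ub : \sum_(k < K) u k @[K --> \oo] --> b 0%N.
  rewrite -cvg_shiftS /=.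
  have -> : (fun K => \sum_(k < K.+1) u k) = (fun K => z + (b 0%N - b (d K))).
    apply/funext => K; rewrite big_ord_recl /=; congr (_ + _).
    elim: K => [|K IH]; first by rewrite big_ord0 d0 subrr.
    by rewrite big_ord_recr /= IH /v addrA subrK.
  suff : z + (b 0%N - b (d K)) @[K --> \oo] --> z + (b 0%N - z).
    by rewrite [z + (b 0%N - z)]addrC subrK.
  apply: cvgD; first exact: cvg_cst.
  by apply: cvgB => //; exact: cvg_cst.
have [wv wvP] := choice vpiece.
pose w k := if k is j.+1 then wv j else wz.
have w0 k n : 0 <= w k n by case: k => [|k] //=; case: (wvP k).
have w1 k : exists N, forall M, (N <= M)%N -> \sum_(n < M) w k n = 1.
  by case: k => [|k] //=; case: (wvP k).
have [y [yu yb]] := sum_rearrangement uT ub w0 w1.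
exists y; split=> // n t e t0 e0.
have [K hK] : exists K, `|y n - \sum_(k < K.+1) w k n *: u k| <= e / t.
  have et0 : 0 < e / t by rewrite divr_gt0.
  have yu' := yu n; rewrite -cvg_shiftS /= in yu'.
  have /cvgrPdist_le/(_ _ et0)[K _ h] := yu'.
  by exists K; apply: h => /=.
rewrite -[y n](subrK (\sum_(k < K.+1) w k n *: u k)) linearD addrC.
apply: splits_withinW (splits_withinD (ltW t0) _ (splits_within0r _ _ _ _));
  last first.
  rewrite linear_sum.
  apply: (@splits_within_sum _ _ _ _ _ _ t (fun k => i1 (w k n *: u k))
    (fun k => if k is j.+1 then 128 * m n j t else 128 * phi n t) K.+1 (ltW t0)).
  by case=> [|k] /=; [exact: wzB | case: (wvP k) => _ _; apply].
rewrite big_ord_recl /= -mulr_sumr.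
have hm : \sum_(k < K) m n k t <= 2 * phi n t.
  exact: (node_mass_sum (phiQ n) tau0 tau_homo K t0).
have : t * `|y n - \sum_(k < K.+1) w k n *: u k| <= e by rewrite mulrC -ler_pdivlMr.
lra.
Unshelve. all: by end_near. Qed.

End RightHalf.

(** * Positive summands *)

(** Concavity between 0 and [t], together with the value 0 at 0. *)
Lemma Conv_quasiconcave (R : realType) (phi : R -> R) : Conv phi -> quasiconcave phi.
Proof.
case=> cvx homo phi0.
have itv0 (t : R) : 0 <= t -> t \in `[0, +oo[ by move=> t0; rewrite in_itv/= t0.
split=> [t t0|s t s0 st].
  by rewrite -phi0; apply: homo; rewrite ?itv0// ltW.
have t0 : 0 < t := lt_le_trans s0 st.
split; first by apply: homo; rewrite ?itv0// ltW.
have l0 : 0 <= s / t by rewrite divr_ge0// ltW.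
have l1 : s / t <= 1 by rewrite ler_pdivrMr// mul1r.
have : - phi (s / t * t + (1 - s / t) * 0) <= s / t * - phi t + (1 - s / t) * - phi 0.
  by apply: (cvx (Itv01 l0 l1) t 0); rewrite inE /= in_itv /= ?lexx ?ltW.
rewrite mulr0 addr0 divfK ?gt_eqF// phi0 oppr0 mulr0 addr0 mulrN lerN2 => h.
by rewrite ler_pdivlMr//; have -> : phi t / t * s = s / t * phi t by ring.
Qed.

Lemma quasiconcave_reflect (R : realType) (phi : R -> R) :
  quasiconcave phi -> quasiconcave (fun t => t * phi t^-1).
Proof.
move=> [p0 pm]; split=> [t t0|s t s0 st].
  by rewrite mulr_ge0 ?(ltW t0)// p0// invr_gt0.
have t0 : 0 < t := lt_le_trans s0 st.
have it0 : 0 < t^-1 by rewrite invr_gt0.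
have its : t^-1 <= s^-1 by rewrite lef_pV2.
have [h1 h2] := pm _ _ it0 its.
split; first by move: h2; rewrite !invrK mulrC (mulrC _ t).
by rewrite ![_ * phi _ / _]mulrAC !divff ?gt_eqF// !mul1r.
Qed.

Section PositiveSeries.
Variables (R : realType) (X : banach_lattice_couple R).
Local Notation splits := (splits_within (emb0 X) (emb1 X)).

Lemma sigma_norm_ge0 (x : ambient X) : sigma_space X x -> 0 <= sigma_norm X x.
Proof.
move=> [x0 [x1 xE]]; apply: lb_le_inf; first by exists (`|x0| + `|x1|), x0, x1.
by move=> _ [y0 [y1 [_ ->]]]; rewrite addr_ge0.
Qed.

(** The positive parts [(x - S_n)^+] of the remainders are dominated by the moduli of
    the remainders of the given series. *)
Lemma positive_series (x : ambient X) (c : nat -> ambient X) (e : nat -> R) : 0 <=v x ->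
  (forall n, splits 1 (x - \sum_(k < n) c k) (e n)) -> e n @[n --> \oo] --> (0 : R) ->
  exists x_ : nat -> ambient X,
    [/\ forall n, 0 <=v x_ n, forall n, x_ n <=v vabs (c n) & sigma_series_cvg X x_ x].
Proof.
move=> x0 xc e0; pose S n := \sum_(k < n) vabs (c k).
have S1 n : S n.+1 = S n + vabs (c n) by rewrite /S big_ord_recr.
pose x_ n := vmeet x (S n.+1) - vmeet x (S n).
exists x_; split=> [n|n|].
- by rewrite vsub_ge0; apply: vmeet_le2; rewrite S1 vle_addr// vabs_ge0.
- by rewrite /x_ S1; apply: vmeetD_sub_le; apply: vabs_ge0.
have sumE n : \sum_(k < n) x_ k = vmeet x (S n).
  elim: n => [|n IH].
    rewrite /S !big_ord0; apply: vle_anti.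
    by rewrite vmeet_glb x0 vle_refl vmeet_ler.
  by rewrite big_ord_recr /= IH addrC subrK.
have cS n : \sum_(k < n) c k <=v S n.
  elim: n => [|n IH]; first by rewrite /S !big_ord0 vle_refl.
  by rewrite S1 big_ord_recr /= vleD// vle_abs.
have split_rest n : splits 1 (x - \sum_(k < n) x_ k) (e n).
  apply: splits_within_solid (xc n) => //; rewrite sumE.
    by rewrite vsub_ge0 vmeet_lel.
  apply: vsub_meet_le; first exact: vabs_ge0.
  apply: vle_trans (vle_abs _).
  rewrite vle_subl -addrA; have := vle_addr x (_ : 0 <=v S n - \sum_(k < n) c k).
  by rewrite vsub_ge0 => /(_ (cS n)); rewrite addrCA addrC -addrA.
apply: (squeeze_cvgr _ (cvg_cst (0 : R)) e0); near=> n.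
rewrite sigma_norm_ge0 ?sigma_normE ?K_functional_le//.
exact: splits_within_sigma (split_rest n).
Unshelve. all: by end_near. Qed.

End PositiveSeries.

(** Summability at 1 propagates to all [t], since [phi n t <= max 1 t * phi n 1]. *)
Lemma real_total (R : realType) (phi : nat -> R -> R) :
  (forall n, quasiconcave (phi n)) ->
  (\sum_(0 <= n <oo) (phi n 1)%:E < +oo)%E ->
  exists F : R -> R, forall t : R, 0 < t ->
    \sum_(n < N) phi n t @[N --> \oo] --> F t /\
    (\sum_(0 <= n <oo) (phi n t)%:E <= (F t)%:E)%E.
Proof.
move=> phiQ fin1.
have E0 t : 0 < t -> forall n, (0 <= n)%N -> true -> (0 <= (phi n t)%:E)%E.
  by move=> t0 n _ _; rewrite lee_fin; apply: (phiQ n).1.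
have [T hT] : exists T, forall N, \sum_(n < N) phi n 1 <= T.
  exists (fine (\sum_(0 <= n <oo) (phi n 1)%:E)%E) => N.
  have S0 : (0 <= \sum_(0 <= n <oo) (phi n 1)%:E)%E by apply: nneseries_ge0; apply: E0.
  rewrite -lee_fin fineK ?ge0_fin_numE// -sumEFin.
  rewrite -(big_mkord xpredT (fun n => (phi n 1)%:E)).
  exact: (nneseries_lim_ge N (E0 _ ltr01)).
exists (fun t => limn (fun N => \sum_(n < N) phi n t)) => t t0.
have homoS : {homo (fun N => \sum_(n < N) phi n t) : m n / (m <= n)%N >-> m <= n}.
  by apply/nondecreasing_seqP => n; rewrite big_ord_recr lerDl; apply: (phiQ n).1.
have cvgS : cvgn (fun N => \sum_(n < N) phi n t).
  apply: nondecreasing_is_cvgn => //; exists (Num.max 1 t * T) => _ [N _ <-].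
  apply: (@le_trans _ _ (Num.max 1 t * \sum_(n < N) phi n 1)); last first.
    by rewrite ler_wpM2l// le_max ler01.
  rewrite mulr_sumr; apply: ler_sum => n _.
  have p1 := (phiQ n).1 1 ltr01.
  case: (leP t 1) => t1.
    by rewrite mul1r; have [] := (phiQ n).2 _ _ t0 t1.
  have [_] := (phiQ n).2 _ _ ltr01 (ltW t1).
  by rewrite divr1 ler_pdivrMr// mulrC.
split=> //; apply: lime_le; first by apply: is_cvg_nneseries; apply: E0.
near=> N; rewrite sumEFin lee_fin big_mkord.
exact: nondecreasing_cvgn_le.
Unshelve. all: by end_near. Qed.

(** * Divisibility of the K-functional *)

Section Divisibility.
Variables (R : realType) (V0 V1 : completeNormedModType R) (H : lmodType R).
Variables (i0 : {linear V0 -> H}) (i1 : {linear V1 -> H}).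
Variables (phi : nat -> R -> R) (F : R -> R).
Hypothesis phiQ : forall n, quasiconcave (phi n).
Hypothesis phiF : forall t : R, 0 < t -> \sum_(n < N) phi n t @[N --> \oo] --> F t.
Hypothesis F_gt0 : forall t : R, 0 < t -> 0 < F t.

(** One decomposition of [x] at [t = 1] serves both halves, since [2 ^+ 0] is its own
    inverse: the second component is divided by [right_half] for the given couple, the
    first one by [right_half] for the exchanged couple. *)
Lemma K_divisibility (x : H) :
  (forall t, 0 < t -> splits_within i0 i1 t x (2 * F t)) ->
  exists (c : nat -> H) (r : nat -> R),
    [/\ forall n (t e : R), 0 < t -> 0 < e ->
          splits_within i0 i1 t (c n) (768 * phi n t + e),
        forall n, splits_within i0 i1 1 (x - \sum_(k < n) c k) (r n) &
        r n @[n --> \oo] --> (0 : R)].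
Proof.
move=> xF.
have decP (t : R) : exists p : V0 * V1, 0 < t ->
    x = i0 p.1 + i1 p.2 /\ `|p.1| + t * `|p.2| <= 2 * F t.
  have [t0|nt] := pselect (0 < t); last by exists (0, 0).
  by have [x0 [x1 h]] := xF t t0; exists (x0, x1).
have [dec decE] := choice decP.
have dec1 t : 0 < t -> `|(dec t).1| <= 2 * F t.
  move=> t0; apply: le_trans (decE t t0).2; rewrite lerDl.
  by rewrite mulr_ge0// ltW.
have dec2 t : 0 < t -> t * `|(dec t).2| <= 2 * F t.
  by move=> t0; apply: le_trans (decE t t0).2; rewrite lerDr.
have p0 j : 0 < 2 ^+ j :> R by apply: exprn_gt0.
have ip0 j : 0 < (2 ^+ j)^-1 :> R by rewrite invr_gt0.
have [|j|j|y [ycvg yK]] := @right_half R V0 V1 H i0 i1 phi F phiQ phiF F_gt0 x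
  (fun j => (dec (2 ^+ j)).1) (fun j => (dec (2 ^+ j)).2).
- by move=> j; apply: (decE _ (p0 j)).1.
- exact: dec1.
- exact: dec2.
have [n|t t0|t t0|j|j|j|z [zcvg zK]] := @right_half R V1 V0 H i1 i0
  (fun n t => t * phi n t^-1) (fun t => t * F t^-1) _ _ _ x
  (fun j => (dec (2 ^+ j)^-1).2) (fun j => (dec (2 ^+ j)^-1).1).
- exact: quasiconcave_reflect.
- under eq_fun do rewrite -mulr_sumr.
  by apply: cvgMl_tmp; apply: phiF; rewrite invr_gt0.
- by rewrite mulr_gt0// F_gt0// invr_gt0.
- by rewrite addrC; apply: (decE _ (ip0 j)).1.
- by rewrite mulrCA -ler_pdivrMl// dec2.
- by rewrite mulrCA ler_pM2l// dec1.
have dec01 : x = i0 (dec 1).1 + i1 (dec 1).2 by apply: (decE _ ltr01).1.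
rewrite expr0 in ycvg; rewrite expr0 invr1 in zcvg.
exists (fun n => i0 (z n) + i1 (y n)),
  (fun n => `|(dec 1).1 - \sum_(k < n) z k| + `|(dec 1).2 - \sum_(k < n) y k|).
split=> [n t e t0 e0|n|].
- have it0 : 0 < t^-1 by rewrite invr_gt0.
  have e2 : 0 < e / 2 by lra.
  have hz := splits_within_swap t0 (zK n t^-1 (e / 2 / t) it0 (divr_gt0 e2 t0)).
  apply: splits_withinW (splits_withinD (ltW t0) hz (yK n t _ t0 e2)).
  have -> : t * (384 * (t^-1 * phi n t^-1^-1) + e / 2 / t) = 384 * phi n t + e / 2.
    by rewrite invrK; field; rewrite gt_eqF.
  lra.
- exists ((dec 1).1 - \sum_(k < n) z k), ((dec 1).2 - \sum_(k < n) y k).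
  split; last by rewrite mul1r.
  by rewrite big_split !linearB (linear_sum i0) (linear_sum i1) opprD {1}dec01 addrACA.
- have dist0 (V : completeNormedModType R) (u : nat -> V) (l : V) :
      u n @[n --> \oo] --> l -> `|l - u n| @[n --> \oo] --> (0 : R).
    move=> /cvgrPdist_le ul; apply/cvgr0Pnorm_le => e e0.
    by apply: filterS (ul e e0) => k; rewrite normr_id.
  have := cvgD (dist0 _ _ _ zcvg) (dist0 _ _ _ ycvg).
  by rewrite addr0; apply.
Qed.

End Divisibility.

Theorem theorem4p1 (R : realType) :
  exists gamma' : R, 0 < gamma' /\
  forall (X : banach_lattice_couple R) (x : ambient X),
    sigma_space X x -> 0 <=v x ->
  forall phi : nat -> R -> R,
    (forall n, Conv (phi n)) ->
    (\sum_(0 <= n <oo) (phi n 1)%:E < +oo)%E ->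
    (forall t : R, 0 < t ->
      ((K_functional X t x)%:E <= \sum_(0 <= n <oo) (phi n t)%:E)%E) ->
  exists x_ : nat -> ambient X,
    [/\ forall n, sigma_space X (x_ n),
        forall n, 0 <=v x_ n,
        sigma_series_cvg X x_ x
      & forall n (t : R), 0 < t -> K_functional X t (x_ n) <= gamma' * phi n t].
Proof.
exists 768; split=> [|X x xS x0 phi phiC fin1 Kphi]; first by rewrite ltr0n.
have phiQ n := Conv_quasiconcave (phiC n).
have [F hF] := real_total phiQ fin1.
have phiF t : 0 < t -> \sum_(n < N) phi n t @[N --> \oo] --> F t by move=> /hF[].
have KF (t : R) : 0 < t -> K_functional X t x <= F t.
  by move=> t0; rewrite -lee_fin (le_trans (Kphi t t0))//; case: (hF t t0).
have [F0 Fm] := total_quasiconcave phiQ phiF.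
(* if all [phi n] vanish, decompositions with the bound [2 * F t = 0] need not
   exist, but then [K_functional X t x = 0] and [x] itself is the series *)
have [F1|F1] := leP (F 1) 0.
  have Fle0 t : 0 < t -> F t <= 0.
    move=> t0; case: (leP t 1) => t1; first by apply: le_trans F1; have [] := Fm _ _ t0 t1.
    have [_] := Fm _ _ ltr01 (ltW t1).
    rewrite divr1 ler_pdivrMr// => /le_trans; apply.
    by rewrite mulr_le0_ge0// ltW.
  pose x_ n := if n is 0%N then x else 0.
  have phi0 n t : 0 < t -> 0 <= 768 * phi n t.
    by move=> t0; rewrite mulr_ge0 ?ler0n//; apply: (phiQ n).1.
  have K0 t : 0 < t -> K_functional X t 0 <= 0.
    by move=> t0; apply: K_functional_le (splits_within0 _ _ _); apply: ltW.
  have S0 : sigma_space X 0 by exists 0, 0; rewrite !linear0 addr0.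
  exists x_; split.
  - by case.
  - by case=> //= n; apply: vle_refl.
  - apply: cvg_near_cst; exists 1%N => // -[//|n] _ /=.
    rewrite big_ord_recl big1//= addr0 subrr; apply/eqP.
    by rewrite eq_le sigma_norm_ge0// sigma_normE K0.
  - case=> [|n] t t0; last by apply: le_trans (K0 t t0) (phi0 _ _ t0).
    exact: le_trans (KF t t0) (le_trans (Fle0 t t0) (phi0 _ _ t0)).
have F_gt0 t : 0 < t -> 0 < F t.
  move=> t0; case: (leP t 1) => t1.
    have [_] := Fm _ _ t0 t1; rewrite divr1 => h.
    by rewrite -(pmulr_lgt0 (F t) (_ : 0 < t^-1)) ?invr_gt0// (lt_le_trans F1).
  by apply: (lt_le_trans F1); have [] := Fm _ _ ltr01 (ltW t1).
have [|c [r [cK cr r0]]] := @K_divisibility R (couple0 X) (couple1 X) (ambient X)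
    (emb0 X) (emb1 X) phi F phiQ phiF F_gt0 x.
  move=> t t0; apply: K_functional_lt_splits => //; first exact: ltW.
  by apply: le_lt_trans (KF t t0) _; have := F_gt0 t t0; lra.
have [x_ [x_0 x_c xcvg]] := positive_series x0 cr r0.
have x_K n (t e : R) : 0 < t -> 0 < e ->
    splits_within (emb0 X) (emb1 X) t (x_ n) (768 * phi n t + e).
  by move=> t0 e0; apply: splits_within_solid (cK n t e t0 e0) => //; apply: ltW.
exists x_; split=> // [n|n t t0].
  exact: splits_within_sigma (x_K n 1 1 ltr01 ltr01).
by apply/ler_addgt0Pr => e e0; apply: K_functional_le (x_K n t e t0 e0); apply: ltW.
Qed.
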